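(* Let $k \geq 3$ be an integer and let $p = p(n)$ satisfy $p = \omega(1/n^{k-1})$, i.e. $p\, n^{k-1} \to \infty$. Let $\mathcal{H} \sim \mathcal{H}_k(n,p)$ and $M = M(\mathcal{H})$. Then asymptotically almost surely (i.e. with probability tending to $1$ as $n \to \infty$) the abelian group $\operatorname{coker}(M) = \mathbb{Z}^n / \operatorname{Im}(M)$ is torsion-free.
   Context: For a $k$-uniform hypergraph $\mathcal{H}$ on vertex set $[n]=\{1,\dots,n\}$, $M(\mathcal{H})$ is the integer matrix with rows indexed by the vertices and columns indexed by the hyperedges of $\mathcal{H}$, defined as follows: for a hyperedge $e=\{v_1,\dots,v_k\}$ with $v_1<v_2<\cdots<v_k$, $M(v_i,e) = (-1)^{i+1}$ for $1\le i\le k$, and $M(v,e)=0$ for $v\notin e$. $\mathcal{H}_k(n,p)$ denotes the Erdős–Rényi random $k$-uniform hypergraph on $[n]$ in which each $k$-subset of $[n]$ is included as a hyperedge independently with probability $p$. *)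

(* Defs.v *)
From HB Require Import structures.
From mathcomp Require Import all_boot all_order all_algebra.
From mathcomp Require Import all_classical all_reals all_analysis.

Set Implicit Arguments.
Unset Strict Implicit.
Unset Printing Implicit Defensive.

Import Order.TTheory GRing.Theory Num.Theory.
Import numFieldNormedType.Exports.
Local Open Scope ring_scope.

(* The vertex set [n] is 'I_n, i.e. 0, ..., n-1; only the order of the vertices
   matters below. *)
Definition kedge (n k : nat) : finType := {e : {set 'I_n} | #|e| == k}.

Definition hypergraph (n k : nat) : finType := {set kedge n k}.

(* For v \in e this is the 1-based position i of v when e is listed
   increasingly as v_1 < ... < v_k. *)
Definition vpos (n : nat) (e : {set 'I_n}) (v : 'I_n) : nat :=
  #|[set u in e | (u <= v)%N]|.

Definition incidence (n k : nat) (H : hypergraph n k) : 'M[int]_(n, #|H|) :=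
  \matrix_(v < n, j < #|H|) let e : {set 'I_n} := val (enum_val j) in
    if v \in e then (-1) ^+ (vpos e v).+1 else 0.

Section Cokernel.
Variables (m n : nat) (M : 'M[int]_(m, n)).

Definition im_mx : {pred 'cV[int]_m} :=
  fun y => `[< exists x : 'cV[int]_n, y = M *m x >].

Fact im_mx_zmod_closed : zmod_closed im_mx.
Proof.
split=> [|y z].
  by apply/asboolP; exists 0; rewrite mulmx0.
move=> /asboolP[x ->] /asboolP[x' ->]; apply/asboolP.
by exists (x - x'); rewrite mulmxBr.
Qed.

HB.instance Definition _ :=
  GRing.isZmodClosed.Build 'cV[int]_m im_mx im_mx_zmod_closed.

Definition coker : zmodType := Quotient.quot im_mx.

End Cokernel.

Definition torsion_free (A : zmodType) : Prop :=
  forall (x : A) (d : nat), (0 < d)%N -> x *+ d = 0 -> x = 0.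

Section RandomHypergraph.
Variables (R : realType) (n k : nat) (p : R).

(* The law of H_k(n,p): a product of independent Bernoulli(p) choices, one for
   each k-subset of the vertices. *)
Definition Hknp_mass (H : hypergraph n k) : R :=
  \prod_(e : kedge n k) (if e \in H then p else 1 - p).

Definition Hknp_prob (E : hypergraph n k -> Prop) : R :=
  \sum_(H : hypergraph n k | `[< E H >]) Hknp_mass H.

Lemma Hknp_mass_ge0 (H : hypergraph n k) : 0 <= p <= 1 -> 0 <= Hknp_mass H.
Proof.
by case/andP=> p0 p1; apply: prodr_ge0 => e _; case: ifP; rewrite ?subr_ge0.
Qed.

Lemma Hknp_mass_sum1 : \sum_(H : hypergraph n k) Hknp_mass H = 1.
Proof.
rewrite -(bigA_distr _ _ (fun=> p) (fun=> 1 - p)) big1 // => e _.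
by rewrite /= addrC subrK.
Qed.

End RandomHypergraph.

Arguments Hknp_prob {R} n k p E.

(* Main.v *)
(** A prime (or any modulus) q contributes torsion only if some integer vector
    orthogonal modulo q to all the columns of M does not lift to a vector
    orthogonal to them over the integers.  Two events exclude this.

    First, for every q simultaneously, such vectors are constant modulo q off
    a set of at most n/g vertices.  Otherwise choose in H a longest chain of
    edges each lying outside the lattice spanned by the previous ones.  Its
    length is O(n): a new edge either raises the rank, multiplying the maximal
    minors of a basis by at most k, or at least halves them.  This set T of
    O(n) edges determines a fixed set V(T) of a positive proportion of all
    possible edges, none of which is in H, and a union bound over T applies.

    Second, for every small nonempty vertex set S met by no edge in exactly
    one vertex, the sum of |e & S| - 1 over the edges e meeting S is less than
    |S|.  By an exponential moment bound, S fails with probability at most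
    (C |S|/n)^|S| exp(-c |S| p n^(k-1)).

    If both hold, let S be the support modulo q of a vector as above, after
    subtracting a constant.  The traces of the edges on S can be removed one by
    one, each of them having at the time of removal a vertex of its own, and
    adjusting the vector at these vertices lifts it. *)

Require Import Defs.
From mathcomp Require Import all_boot all_order all_algebra.
From mathcomp Require Import all_classical all_reals all_analysis.
From mathcomp Require Import generic_quotient zify ring lra.
(* After classical_sets, so that set0, setI, subsetP are those of finset. *)
From mathcomp Require Import fintype finset.
Import Order.TTheory GRing.Theory Num.Theory.
Import numFieldNormedType.Exports.
Local Open Scope ring_scope.

Set Implicit Arguments.
Unset Strict Implicit.
Unset Printing Implicit Defensive.

(** * Torsion and lifting of orthogonal vectors *)

(** In Smith normal form [M = L D' R], membership of [x0] in the image means that [D_i] divides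
    coordinate [i] of [L^-1 x0]. Row [i] of [L^-1] is orthogonal to [M] modulo [D_i], so it lifts to
    some [Z] with [Z M = 0]; since [d x0] is in the image, [Z x0 = 0], and the coordinate vanishes
    modulo [D_i]. *)
Lemma coker_torsion_free (m n : nat) (M : 'M[int]_(m, n)) :
  (forall (q : int) (Y : 'rV[int]_m), (forall j, (q %| (Y *m M) ord0 j)%Z) ->
     exists2 Z : 'rV[int]_m, Z *m M = 0 & forall i, (q %| Z ord0 i - Y ord0 i)%Z) ->
  torsion_free (coker M).
Proof.
have pi_eq0 y : \pi_(coker M)%qT y = 0 <-> exists z, y = M *m z.
  have -> : 0 = \pi_(coker M)%qT 0 by rewrite raddf0.
  split=> [/eqP|Ez]; first by rewrite -Quotient.idealrBE subr0 => /asboolP.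
  by apply/eqP; rewrite -Quotient.idealrBE subr0; apply/asboolP.
move=> lift x d d_gt0; rewrite -[x]reprK; set x0 := repr x.
rewrite -raddfMn => /pi_eq0[z Ez]; apply/pi_eq0.
have [L L_unit [R R_unit [D _ defM]]] := int_Smith_normal_form M.
set D' := (\matrix_(i, j) _) in defM.
have D'E (b : 'cV[int]_n) (i : 'I_m) :
    (D' *m b) i 0 = D`_i * (if insub (i : nat) is Some j then b j 0 else 0).
  rewrite mxE; case: insubP => [j ltin ij|]; last first.
    rewrite -leqNgt mulr0 => lein; rewrite big1 // => j _.
    rewrite mxE; case: eqP => [ij|_]; last exact: mul0r.
    by rewrite ij leqNgt ltn_ord in lein.
  rewrite (bigD1 j) //= mxE ij eqxx big1 ?addr0 // => j' ne.
  rewrite mxE -ij; case: eqP => [/val_inj E|_]; last exact: mul0r.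
  by rewrite E eqxx in ne.
have key i : exists b : int, (invmx L *m x0) i 0 = D`_i * b /\ (n <= i -> b = 0)%N.
  have E : (invmx L *m x0) i 0 *+ d =
      D`_i * (if insub (i : nat) is Some j then (R *m z) j 0 else 0).
    rewrite -D'E.
    have -> : D' *m (R *m z) = invmx L *m (x0 *+ d).
      by rewrite Ez defM !mulmxA mulVmx // mul1mx.
    by rewrite raddfMn /= mulmxnE.
  (* Rows beyond the width of [D'] are zero, so there [d] times the coordinate is 0. *)
  case: insubP E => [j ltin ij|nlt] E; last first.
    exists 0; split=> //; rewrite mulr0.
    move/eqP: E; rewrite mulr0 mulrn_eq0 (gtn_eqF d_gt0) /= => /eqP //.
  suff /dvdzP[b ->] : (D`_i %| (invmx L *m x0) i ord0)%Z.
    by exists b; rewrite mulrC; split=> //; rewrite leqNgt ltin.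
  have [l|Z ZM0 ZY] := lift D`_i (row i (invmx L)).
    rewrite -row_mul defM !mulmxA mulVmx // mul1mx !mxE rpred_sum // => l' _.
    by rewrite !mxE dvdz_mulr //; case: eqP => _; rewrite ?mulr0n ?mulr1n ?dvdzz ?dvdz0.
  have Zx0 : (Z *m x0) 0 0 = 0.
    have : (Z *m (x0 *+ d)) 0 0 = 0 by rewrite Ez mulmxA ZM0 mul0mx mxE.
    by rewrite raddfMn /= mulmxnE => /eqP; rewrite mulrn_eq0 (gtn_eqF d_gt0) /= => /eqP.
  rewrite -[X in (_ %| X)%Z]subr0 -[X in _ - X]Zx0 !mxE -sumrB rpred_sum // => l _.
  rewrite -mulrBl dvdz_mulr //.
  by rewrite -rpredN opprB; have := ZY l; rewrite !mxE.
pose b i := projT1 (cid (key i)).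
have bE i : (invmx L *m x0) i 0 = D`_i * b i by rewrite /b; case: cid => b' [].
have b0 (i : 'I_m) : (n <= i)%N -> b i = 0 by rewrite /b; case: cid => b' [].
exists (invmx R *m \col_(j < n) (if (insub (j : nat) : option 'I_m) is Some i then b i else 0)).
rewrite defM !mulmxA mulmxK // -mulmxA -[LHS]mul1mx -(mulmxV L_unit) -mulmxA.
congr (_ *m _); apply/matrixP => i o; rewrite ord1 D'E bE; congr (_ * _).
case: insubP => [j ltin ij|]; last by rewrite -leqNgt => /b0.
rewrite mxE; case: insubP => [i' _ i'j|].
  by congr b; apply: val_inj; rewrite /= i'j.
by rewrite ij ltn_ord.
Qed.


(** * Alternating sums over vertex sets *)

Definition altsum (n : nat) (Y : 'I_n -> int) (B : {set 'I_n}) : int :=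
  \sum_(v in B) (-1) ^+ (vpos B v).+1 * Y v.

(** The new least vertex takes position 1 and shifts all others by one, which flips their signs. *)
Lemma altsumU1 (n : nat) (Y : 'I_n -> int) (u : 'I_n) (B : {set 'I_n}) :
  (forall v, v \in B -> (u < v)%N) -> altsum Y (u |: B) = Y u - altsum Y B.
Proof.
move=> ltuB; have uB : u \notin B by apply/negP => /ltuB; rewrite ltnn.
rewrite /altsum big_setU1 //= -sumrN; congr (_ + _).
  rewrite /vpos (_ : [set w in u |: B | (w <= u)%N] = [set u]) ?cards1 ?sqrrN ?expr1n ?mul1r //.
  apply/setP => w; rewrite !inE; case: eqVneq => [->|ne] /=; first exact: leqnn.
  by apply/negP => /andP[/ltuB]; rewrite ltnNge => /negP.
apply: eq_bigr => v vB; rewrite -mulNr /vpos.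
rewrite (_ : [set w in u |: B | (w <= v)%N] = u |: [set w in B | (w <= v)%N]).
  by rewrite cardsU1 inE (negbTE uB) /= add1n [in LHS]exprS mulN1r.
by apply/setP => w; rewrite !inE; case: eqVneq => [->|ne] //=; rewrite ltnW ?ltuB.
Qed.

Lemma altsum_const (n : nat) (c : int) (B : {set 'I_n}) :
  altsum (fun=> c) B = if odd #|B| then c else 0.
Proof.
move Em: #|B| => m; elim: m B Em => [|m IH] B Em.
  by rewrite (cards0_eq Em) /altsum big_set0.
have /set0Pn[v0 v0B] : B != set0 by rewrite -card_gt0 Em.
case: (arg_minnP (fun v : 'I_n => v : nat) v0B) => u uB umin.
have {}uB : u \in B := uB.
have Bu : #|B :\ u| = m by move: Em; rewrite (cardsD1 u) uB add1n => -[].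
have ltuB v : v \in B :\ u -> (u < v)%N.
  by rewrite !inE => /andP[ne /umin]; rewrite leq_eqVlt eq_sym (inj_eq val_inj) (negbTE ne).
rewrite -(setD1K uB) altsumU1 ?IH ?Bu ?cardsU1 ?setD11 ?Bu //.
by rewrite /=; case: odd; rewrite ?subrr ?subr0.
Qed.

Lemma altsumB (n : nat) (Y Z : 'I_n -> int) (B : {set 'I_n}) :
  altsum Y B - altsum Z B = altsum (fun v => Y v - Z v) B.
Proof. by rewrite /altsum -sumrB; apply: eq_bigr => v _; rewrite mulrBr. Qed.

Lemma dvdz_altsum (n : nat) (q : int) (Y : 'I_n -> int) (B : {set 'I_n}) :
  (forall v, v \in B -> (q %| Y v)%Z) -> (q %| altsum Y B)%Z.
Proof. by move=> qY; apply: rpred_sum => v /qY; exact: dvdz_mull. Qed.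

Lemma mul_incidence (n k : nat) (H : hypergraph n k) (Y : 'rV[int]_n) (j : 'I_#|H|) :
  (Y *m incidence H) ord0 j = altsum (fun v => Y ord0 v) (val (enum_val j)).
Proof.
rewrite mxE /altsum [RHS]big_mkcond; apply: eq_bigr => v _.
by rewrite mxE /=; case: ifP; rewrite ?mulr0 // mulrC.
Qed.

(* For a small nonempty set S of vertices meeting no edge in exactly one
   vertex, the traces of the edges on S are too few to contain a cycle. *)
Definition locally_sparse (n k g : nat) (H : hypergraph n k) : Prop :=
  forall S : {set 'I_n}, S != set0 -> (g * #|S| <= n)%N ->
    (forall e, e \in H -> #|val e :&: S| != 1%N) ->
    (\sum_(e in H) #|val e :&: S|.-1 < #|S|)%N.

(** * Peeling off edges to lift a vector of small support *)

Section Peeling.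
Variables (n k g : nat) (H : hypergraph n k) (S : {set 'I_n}).
Hypothesis sparseH : locally_sparse g H.
Hypothesis smallS : (g * #|S| <= n)%N.
Hypothesis closedS : forall e, e \in H -> #|val e :&: S| != 1%N.

Let cover_in (F : {set kedge n k}) := S :&: \bigcup_(e in F) val e.
Let touching (F : {set kedge n k}) :=
  [&& F \subset H, F != set0 & [forall e in F, val e :&: S != set0]].

(* A maximal violating F would span a set which no further edge touches. *)
Lemma trace_sum_lt (F : {set kedge n k}) :
  touching F -> (\sum_(e in F) #|val e :&: S|.-1 < #|cover_in F|)%N.
Proof.
move=> tF; rewrite ltnNge; apply/negP => badF.
pose P F := touching F && (#|cover_in F| <= \sum_(e in F) #|val e :&: S|.-1)%N.
have [F' maxF' _] : {F' | maxset P F' & F \subset F'}.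
  by apply: maxset_exists; rewrite /P tF badF.
case/maxsetP: maxF' => /andP[/and3P[sF'H nF' tF'] badF'] maxF'.
set A := cover_in F' in badF'.
have AE e : e \in F' -> val e :&: A = val e :&: S.
  move=> eF'; apply/setP => v; rewrite !inE; case ve: (v \in _) => //=.
  case: (v \in S) => //=; apply/bigcupP; by exists e.
have A0 e : e \in H -> e \notin F' -> val e :&: A = set0.
  move=> eH eF'; apply/eqP; apply: contraT => neA; case/negP: (eF').
  have neS : val e :&: S != set0.
    by apply: contra_neq neA => eS; rewrite setIA eS set0I.
  rewrite -(maxF' (e |: F')) ?setU11 ?subsetUr //.
  apply/andP; split.
    apply/and3P; split; first by rewrite subUset sub1set eH.
      by apply/set0Pn; exists e; rewrite setU11.
    apply/forall_inP => e'; rewrite !inE => /predU1P[->//|].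
    exact: (forall_inP tF').
  rewrite big_setU1 //=.
  have -> : cover_in (e |: F') = (val e :&: S) :|: A.
    by rewrite /cover_in bigcup_setU big_set1 setIUr (setIC (val e)).
  have eSA : (val e :&: S) :&: A = val e :&: A by rewrite -setIA (setIA S) setIid.
  rewrite cardsU eSA.
  (* An edge meeting [A] adds at most [#|val e :&: S| - 1] new vertices to it, so adding the edge to
     [F'] would preserve the violation, against maximality. *)
  move: neS neA badF'; rewrite -!card_gt0.
  move: #|val e :&: S| #|val e :&: A| #|A| (\sum_(i in F') _)%N => x y a D.
  by lia.
have nA : A != set0.
  case/set0Pn: nF' => e1 eF1; have := forall_inP tF' _ eF1.
  by rewrite -(AE e1 eF1); apply: contra_neq => ->; rewrite setI0.
have : (\sum_(e in H) #|val e :&: A|.-1 < #|A|)%N.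
  apply: sparseH => // [|e1 e1H].
    by rewrite (leq_trans _ smallS) // leq_mul2l subset_leq_card ?orbT // subsetIl.
  have [eF'|eF'] := boolP (e1 \in F'); first by rewrite AE ?closedS.
  by rewrite A0 ?cards0.
rewrite ltnNge => /negP; apply; apply: leq_trans badF' _.
rewrite [leqRHS](big_setID F') /= (setIidPr sF'H).
apply: leq_trans (leq_addr _ _).
by apply: leq_sum => e1 /AE ->.
Qed.

(** Double counting: if every covered vertex were in two edges of [F], twice the cover would be at
    most the sum of the trace sizes. Traces have size at least 2, so this sum is at most twice the
    sum of the sizes less one, contradicting [trace_sum_lt]. *)
Lemma exists_private_vertex (F : {set kedge n k}) : touching F ->
  exists e w, [/\ e \in F, w \in val e, w \in S &
    forall e', e' \in F -> w \in val e' -> e' = e].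
Proof.
move=> tF; have [sFH nF /forall_inP meets] := and3P tF.
pose deg w := #|[set e in F | w \in val e]|.
have [w /andP[wF degw]|ge2] := pickP (fun w => (w \in cover_in F) && (deg w == 1%N)).
  move: degw wF; rewrite inE => /cards1P[e He] /andP[wS _].
  have : e \in [set e in F | w \in val e] by rewrite He set11.
  rewrite inE => /andP[eF we]; exists e; exists w; split=> // e' e'F we'.
  by apply/set1P; rewrite -He inE e'F.
have := trace_sum_lt tF; rewrite ltnNge => /negP; case.
have dbl : (\sum_(e in F) #|val e :&: S| = \sum_(w in S) deg w)%N.
  under eq_bigr do rewrite -sum1_card big_mkcond /=.
  rewrite exchange_big /= [RHS]big_mkcond; apply: eq_bigr => w _.
  rewrite /deg -sum1_card big_mkcond [in RHS]big_mkcond /=.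
  case wS: (w \in S); last by rewrite big1 // => e _; rewrite inE wS andbF if_same.
  by apply: eq_bigr => e _; rewrite !inE wS andbT; case: (e \in F).
have : (2 * #|cover_in F| <= \sum_(e in F) #|val e :&: S|)%N.
  rewrite dbl (big_setID (cover_in F)) /= (setIidPr (subsetIl _ _)).
  apply: leq_trans (leq_addr _ _); rewrite mulnC -sum_nat_const leq_sum // => w wF.
  have : (0 < deg w)%N.
    move: wF; rewrite inE => /andP[_ /bigcupP[e eF we]].
    by apply/card_gt0P; exists e; rewrite inE eF.
  by have := ge2 w; rewrite /= wF /=; case: (deg w) => [|[|]].
have : (\sum_(e in F) #|val e :&: S| <= 2 * \sum_(e in F) #|val e :&: S|.-1)%N.
  rewrite big_distrr leq_sum //= => e eF.
  have := closedS (subsetP sFH e eF); have := meets e eF.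
  by rewrite -card_gt0; case: #|_| => [|[|m]] //; lia.
by lia.
Qed.

(** Induction on [F]: remove an edge with a private vertex, lift for the remaining edges, and then
    correct the value at that vertex, which no remaining edge sees. *)
Lemma lift_on_small_support (q : int) (F : {set kedge n k}) (Y : 'I_n -> int) :
  F \subset H -> (forall e, e \in F -> val e :&: S != set0) ->
  (forall e, e \in F -> (q %| altsum Y (val e))%Z) ->
  exists Z : 'I_n -> int, [/\ forall v, (q %| Z v - Y v)%Z,
    forall v, v \notin S -> Z v = Y v & forall e, e \in F -> altsum Z (val e) = 0].
Proof.
move Em: #|F| => m; elim: m F Em => [|m IH] F Em sFH meets qF.
  exists Y; split=> // [v|e]; first by rewrite subrr dvdz0.
  by rewrite (cards0_eq Em) inE.
have [|e [w [eF we wS priv]]] := @exists_private_vertex F.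
  by rewrite /touching sFH -card_gt0 Em; apply/forall_inP.
have sF'F : F :\ e \subset F by rewrite subD1set.
have [|||e'|Z [ZY ZS Z0]] := IH (F :\ e).
- by move: Em; rewrite (cardsD1 e) eF add1n => -[].
- exact: subset_trans sFH.
- by move=> e' /(subsetP sF'F)/meets.
- by move=> /(subsetP sF'F)/qF.
(* As the coefficient of [w] is a sign, subtracting [c] at [w] cancels the alternating sum over [e];
   [q] divides [c] because [Z] agrees with [Y] modulo [q]. *)
pose c : int := (-1) ^+ (vpos (val e) w).+1 * altsum Z (val e).
pose Z' v := if v == w then Z v - c else Z v.
have Z'out (e' : kedge n k) : w \notin val e' -> altsum Z' (val e') = altsum Z (val e').
  move=> we'; apply: eq_bigr => v ve'; rewrite /Z'; case: eqP => // vw.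
  by rewrite -vw ve' in we'.
have qc : (q %| c)%Z.
  rewrite /c dvdz_mull // -[X in (_ %| X)%Z](subrK (altsum Y (val e))) rpredD ?qF //.
  by rewrite altsumB dvdz_altsum.
exists Z'; split=> [v|v vS|e' e'F].
- by rewrite /Z'; case: eqP => // _; rewrite addrAC rpredB.
- by rewrite /Z'; case: eqP => [vw|_]; [rewrite -vw (negbTE vS) in wS | exact: ZS].
have [->|ne] := eqVneq e' e; last first.
  by rewrite Z'out ?Z0 ?inE ?ne //; apply: contra_neqN ne => /(priv _ e'F).
have E : altsum Z (val e) = (-1) ^+ (vpos (val e) w).+1 * Z w + \sum_(v in val e | v != w)
   (-1) ^+ (vpos (val e) v).+1 * Z v by rewrite /altsum (bigD1 w).
rewrite /altsum (bigD1 w) //= {1}/Z' eqxx mulrBr /c mulrA -expr2 sqrr_sign mul1r E.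
rewrite opprD addrA [X in X - _]subrr sub0r addrC; apply/eqP; rewrite subr_eq0; apply/eqP.
by apply: eq_bigr => v /andP[_ /negbTE ne]; rewrite /Z' ne.
Qed.
End Peeling.

(* Constant functions are exempted for even k because their alternating sums
   over edges vanish. *)
Definition spread (n k g : nat) (q : int) (Y : 'I_n -> int) : Prop :=
  forall c : int, (odd k -> c = 0) -> (n < g * #|[set v | ~~ (q %| (Y v - c)%R)%Z]|)%N.

Definition kills (n k : nat) (q : int) (Y : 'I_n -> int) (H : {set kedge n k}) : Prop :=
  forall e, e \in H -> (q %| altsum Y (val e))%Z.

Lemma torsion_free_of_sparse (n k g : nat) (H : hypergraph n k) :
  locally_sparse g H -> (forall q Y, kills q Y H -> ~ spread k g q Y) ->
  torsion_free (coker (incidence H)).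
Proof.
move=> sparseH nospread; apply: coker_torsion_free => q y qy.
pose Y v := y ord0 v.
have killY : kills q Y H.
  move=> e eH; have := qy (enum_rank_in eH e).
  by rewrite mul_incidence enum_rankK_in.
have [c [ck small]] : exists c, (odd k -> c = 0) /\
    (g * #|[set v | ~~ (q %| (Y v - c)%R)%Z]| <= n)%N.
  apply: contrapT => /forallNP noc; apply: (nospread q Y killY) => c ck.
  by rewrite ltnNge; apply/negP => le; apply: (noc c).
set S := [set v | _] in small.
have constk e : altsum (fun=> c) (val (e : kedge n k)) = 0.
  by rewrite altsum_const (eqP (valP e)); case: ifP => // /ck.
pose Y0 v := if v \in S then Y v - c else 0.
have Y0Y v : (q %| Y0 v - (Y v - c))%Z.
  rewrite /Y0; case: ifPn; rewrite ?subrr ?dvdz0 // inE negbK sub0r.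
  by rewrite rpredN.
have kill0 e : e \in H -> (q %| altsum Y0 (val e))%Z.
  move=> eH; rewrite -[X in (_ %| X)%Z](subrK (altsum (fun v => Y v - c) (val e))) rpredD //.
    by rewrite altsumB dvdz_altsum.
  by rewrite -altsumB constk subr0 killY.
(* If [w] were the only vertex of [e] in [S], the alternating sum of [Y0] would be [Y0 w] up to
   sign, which [q] does not divide. *)
have closedS e : e \in H -> #|val e :&: S| != 1%N.
  move=> eH; apply/cards1P => -[w eSw].
  have : w \in val e :&: S by rewrite eSw set11.
  rewrite inE => /andP[we wS].
  have := kill0 e eH; rewrite /altsum (bigD1 w) //= big1 => [|v /andP[ve vw]].
    rewrite addr0 /Y0 wS => qw; move: wS; rewrite inE => /negP; apply.
    rewrite -[X in (q %| X)%Z]mul1r -(sqrr_sign _ (vpos (val e) w).+1) expr2 -mulrA.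
    exact: dvdz_mull.
  rewrite /Y0; case: ifPn; rewrite ?mulr0 // => vS.
  have : v \in val e :&: S by rewrite inE ve.
  by rewrite eSw inE (negbTE vw).
pose F := [set e in H | val e :&: S != set0].
have [|||Z [ZY ZS Z0]] := @lift_on_small_support n k g H S sparseH small closedS q F Y0.
- by apply/subsetP => e; rewrite inE => /andP[].
- by move=> e; rewrite inE => /andP[].
- by move=> e; rewrite inE => /andP[/kill0].
have ZH e : e \in H -> altsum Z (val e) = 0.
  move=> eH; have [eS|eS] := eqVneq (val e :&: S) set0; last by rewrite Z0 // inE eH.
  rewrite /altsum big1 // => v ve.
  have vS : v \notin S.
    by apply/negP => vS; have := in_set0 v; rewrite -eS inE ve vS.
  by rewrite ZS // /Y0 (negbTE vS) mulr0.
(* Adding [c] back is harmless: alternating sums of this constant over edges vanish. *)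
exists (\row_v (Z v + c)).
  apply/rowP => j; rewrite mul_incidence !mxE.
  have -> : altsum (fun v => (\row_v (Z v + c)) ord0 v) (val (enum_val j)) =
            altsum (fun v => Z v + c) (val (enum_val j)).
    by apply: eq_bigr => v _; rewrite mxE.
  rewrite -[LHS]subr0 -[X in _ - X](constk (enum_val j)) altsumB -(ZH _ (enum_valP j)).
  by apply: eq_bigr => v _; rewrite addrK.
move=> i; rewrite mxE.
have -> : Z i + c - y ord0 i = (Z i - Y0 i) + (Y0 i - (Y i - c)) by rewrite /Y; ring.
by rewrite rpredD.
Qed.

(** * Chains of lattices *)


(* The pair (q, Y) certifies that x is outside the lattice spanned by s'. *)
Fixpoint independent_chain (n : nat) (s : seq 'cV[int]_n) : Prop :=
  if s is x :: s' then
    independent_chain s' /\ exists (q : int) (Y : 'rV[int]_n),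
      (forall z, z \in s' -> (q %| (Y *m z) ord0 ord0)%Z) /\
      ~~ (q %| (Y *m x) ord0 ord0)%Z
  else True.

(** Cramer's rule: the cofactors along column [i] are still those of [A]. *)
Lemma det_replace_col (R : comNzRingType) (r : nat) (A : 'M[R]_r) (i : 'I_r) (c : 'cV[R]_r) :
  \det (\matrix_(a, j) if j == i then (A *m c) a 0 else A a j) = \det A * c i 0.
Proof.
set A' := \matrix_(a, j) _.
have cofE a : cofactor A' a i = cofactor A a i.
  rewrite /cofactor; congr (_ * \det _); apply/matrixP => a' j.
  by rewrite !mxE eq_sym (negbTE (neq_lift _ _)).
transitivity ((\adj A *m (A *m c)) i 0).
  rewrite (expand_det_col _ i) mxE; apply: eq_bigr => a _.
  by rewrite cofE [A' _ _]mxE eqxx mulrC [\adj A _ _]mxE.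
by rewrite mulmxA mul_adj_mx mul_scalar_mx mxE.
Qed.

(* The third item says dually that the columns of B lie in the lattice spanned
   by s. *)
Lemma chain_basis (n k : nat) (s : seq 'cV[int]_n) :
  independent_chain s -> (forall x, x \in s -> \sum_v `|x v 0| <= k%:R) ->
  exists r (B : 'M[int]_(n, r)),
    [/\ row_full (map_mx (intr : int -> rat) B), (r <= size s)%N,
      (forall (q : int) (Y : 'rV[int]_n),
         (forall z, z \in s -> (q %| (Y *m z) ord0 ord0)%Z) ->
         forall j, (q %| (Y *m B) ord0 j)%Z) &
      forall f : 'I_r -> 'I_n, injective f ->
        `|\det (rowsub f B)| * 2 ^+ (size s - r) <= k%:R ^+ r].
Proof.
elim: s => [_ _|x s IH [chs [q [Y [Ys Yx]]]] sk].
  exists 0%N, (0 : 'M[int]_(n, 0)); split=> // [|q Y _ []//|f _].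
    by rewrite /row_full -leqn0 rank_leq_col.
  by rewrite det_mx00 normr1.
have [|r [B [fullB rs latB minB]]] := IH chs; first by move=> z zs; rewrite sk ?inE ?zs ?orbT.
have kx : \sum_v `|x v 0| <= k%:R by rewrite sk ?mem_head.
set Bq := map_mx _ B in fullB; pose xq := map_mx (intr : int -> rat) x.
(* Outside the rational span of [B], [x] is appended as a column: the rank grows by one, and
   expanding a minor along [x] costs at most a factor [k], the bound on the sum of the absolute
   entries of [x]. *)
have [xB|xB] := boolP (xq^T <= Bq^T)%MS; last first.
  exists r.+1, (row_mx x B : 'M[int]_(n, r.+1)); split=> // [|q' Y' Y's j|f finj].
  - have rk : \rank (row_mx xq Bq) = r.+1.
      apply/eqP; rewrite eqn_leq rank_leq_col -mxrank_tr tr_row_mx -addsmxE.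
      have : (\rank Bq^T < \rank (xq^T + Bq^T)%MS)%N.
        rewrite (ltn_leqif (mxrank_leqif_sup (addsmxSr _ _))).
        by apply: contra xB => /(submx_trans (addsmxSl _ _)).
      by rewrite mxrank_tr (eqP fullB).
    by apply/eqP; move: rk; rewrite -map_row_mx.
  - have YB j' : (q' %| (Y' *m B) ord0 j')%Z.
      by apply: latB => z zs; rewrite Y's // inE zs orbT.
    have Yx' := Y's x (mem_head _ _).
    rewrite (_ : _ *m _ = row_mx (Y' *m x) (Y' *m B)); last exact: mul_mx_row.
    by rewrite mxE; case: split_ordP => i _; rewrite ?ord1.
  - rewrite [(size _ - _)%N]subSS (expand_det_col _ ord0).
    have minorE a : \det (row' a (col' ord0 (rowsub f (row_mx x B : 'M[int]_(n, r.+1))))) =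
        \det (rowsub (f \o lift a) B).
      congr (\det _); apply/matrixP => a' j.
      by rewrite !mxE -rshift1 (unsplitK (inr _)).
    apply: le_trans (ler_wpM2r _ (ler_norm_sum _ _ _)) _; first exact: exprn_ge0.
    rewrite mulr_suml exprS.
    apply: (@le_trans _ _ (\sum_(a < r.+1) `|x (f a) 0| * k%:R ^+ r)).
      apply: ler_sum => a _; rewrite normrM -mulrA.
      have -> : rowsub f (row_mx x B : 'M[int]_(n, r.+1)) a ord0 = x (f a) 0.
        by rewrite !mxE; case: split_ordP => i /(congr1 val) //=; rewrite ord1.
      apply: (ler_wpM2l (normr_ge0 _)); rewrite normrM normrX normrN1 expr1n mul1r minorE minB //.
      by move=> a1 a2 /finj/lift_inj.
    rewrite -mulr_suml ler_wpM2r ?exprn_ge0 ?ler0n //; apply: le_trans kx.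
    rewrite [leRHS](bigID (mem (codom f))) /= -[leLHS]addr0 lerD ?sumr_ge0 //.
    rewrite -(big_imset (fun v => `|x v 0|)) /=; last by move=> ? ? _ _; exact: finj.
    rewrite le_eqVlt; apply/orP; left; apply/eqP/eq_bigl => v; rewrite codomE.
    by apply/imsetP/mapP => -[a _ ->]; exists a; rewrite ?mem_enum.
(* Some coordinate of x in the basis B is not an integer: replace the
   corresponding basis vector by x, reduced modulo B. *)
have [c xE] : exists c, xq = Bq *m c.
  by case/submxP: xB => D xD; exists D^T; rewrite -[xq]trmxK xD trmx_mul trmxK.
have [i ci] : exists i, c i 0 \isn't a Num.int.
  (* With integral coordinates [x] would be in the lattice of [B], whose columns [Y] annihilates
     modulo [q]. *)
  apply: contrapT => /forallNP cint; case/negP: Yx.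
  pose c' : 'cV[int]_r := \col_j Num.floor (c j 0).
  have -> : x = B *m c'.
    apply/matrixP => a o; apply: (@intr_inj rat); rewrite ord1.
    have := congr1 (fun M : 'cV[rat]_n => M a 0) xE; rewrite /= !mxE => ->.
    rewrite rmorph_sum; apply: eq_bigr => j _; rewrite rmorphM /= !mxE floorK //.
    by apply: contrapT => nint; apply: (cint j); apply/negP.
  by rewrite mulmxA mxE rpred_sum // => j _; apply: dvdz_mulr; apply: latB.
(* Rounding to the nearest integer makes [t] at most 1/2 in absolute value, and nonzero since
   [c i 0] is not an integer. By Cramer's rule every maximal minor is multiplied by [t], so it is at
   least halved while the rank stays full. *)
pose d : 'cV[int]_r := \col_j Num.floor (c j 0 + 2^-1).
pose y := x - B *m d; pose t := c i 0 - (d i 0)%:~R.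
pose B' := \matrix_(a, j) if j == i then y a 0 else B a j.
have t_le : `|t| <= 2^-1.
  have /andP[] := floor_itv (c i 0 + 2^-1); rewrite intrD ler_norml /t mxE.
  by move=> lo hi; apply/andP; split; lra.
have t_neq0 : t != 0.
  by apply: contraNneq ci => /subr0_eq ->; exact: intr_int.
have detB' (f : 'I_r -> 'I_n) :
    (\det (rowsub f B'))%:~R = \det (rowsub f Bq) * t.
  have -> : t = (c - map_mx intr d) i 0 by rewrite /t !mxE.
  rewrite -det_replace_col -det_map_mx; congr (\det _); apply/matrixP => a j.
  rewrite !mxE; case: eqP => // _.
  have xqE : (x (f a) 0)%:~R = (Bq *m c) (f a) 0 by rewrite -xE mxE.
  rewrite rmorphB /= xqE !mxE rmorph_sum -sumrB.
  by apply: eq_bigr => l _; rewrite rmorphM !mxE mulrBr.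
exists r, B'; split; first 1 last.
- exact: leqW.
- move=> q' Y' Y's j.
  have YB l : (q' %| (Y' *m B) ord0 l)%Z by apply: latB => z zs; rewrite Y's // inE zs orbT.
  have [->|ji] := eqVneq j i.
    have -> : (Y' *m B') ord0 i = (Y' *m y) ord0 ord0.
      by rewrite !mxE; apply: eq_bigr => a _; rewrite !mxE eqxx.
    rewrite mulmxBr mulmxA [X in (_ %| X)%Z]mxE [X in _ + X]mxE rpredB ?Y's ?mem_head //.
    by rewrite mxE rpred_sum // => l _; apply: dvdz_mulr.
  have -> : (Y' *m B') ord0 j = (Y' *m B) ord0 j; last exact: YB.
  by rewrite !mxE; apply: eq_bigr => a _; rewrite !mxE (negbTE ji).
- move=> f finj; rewrite [(size _ - _)%N](subSn rs) exprS mulrA.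
  apply: le_trans (minB f finj); rewrite ler_wpM2r ?exprn_ge0 //.
  rewrite -(ler_int rat) intrM !intr_norm detB' -det_map_mx map_mxsub -/Bq normrM.
  by have := normr_ge0 (\det (rowsub f Bq)); nra.
have := fullrowsub_unit fullB; rewrite unitmxE unitfE => detf.
have detf' : (\det (rowsub (fullrankfun fullB) B'))%:~R != 0 :> rat.
  by rewrite detB' mulf_neq0.
have : map_mx intr (rowsub (fullrankfun fullB) B') \in (@unitmx rat r).
  by rewrite unitmxE unitfE det_map_mx.
rewrite -row_full_unit map_mxsub /row_full eqn_leq => /andP[_ rkr].
by rewrite eqn_leq rank_leq_col (leq_trans rkr) // mxrankS // rowsub_sub.
Qed.

(** A nonzero integral minor is at least 1 in absolute value, so the number of halvings is bounded:
    [2 ^ (size s - r) <= k ^ r <= 2 ^ (k * r)], with [r <= n]. *)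
Lemma size_independent_chain (n k : nat) (s : seq 'cV[int]_n) :
  independent_chain s -> (forall x, x \in s -> \sum_v `|x v 0| <= k%:R) ->
  (size s <= k.+1 * n)%N.
Proof.
move=> chs sk; have [r [B [fullB rs' _ minB]]] := chain_basis chs sk.
have rn : (r <= n)%N by rewrite -(eqP fullB) rank_leq_row.
have := minB _ (@fullrankfun_inj _ _ _ _ fullB).
have := fullrowsub_unit fullB; rewrite unitmxE unitfE -map_mxsub det_map_mx intr_eq0.
set dt := \det _ => dt0 le.
have : (2 ^ (size s - r) <= k ^ r)%N.
  rewrite -(ler_nat int) !natrX; apply: le_trans le.
  by rewrite -[leLHS]mul1r ler_wpM2r ?exprn_ge0 // -gtz0_ge1 normr_gt0.
have kr : (k ^ r <= 2 ^ (k * r))%N.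
  by rewrite expnM; case: (r) => // r'; rewrite leq_exp2r // ltnW // ltn_expl.
move=> /leq_trans/(_ kr); rewrite leq_exp2l //.
by move: (size s) rs' => l rs'; nia.
Qed.

(** * Counting edges *)


(** Each factor of the falling factorial of [n %/ a] is at least [n / (2 * a)]. Thus a set of
    [n / a] vertices still contains a constant proportion of all [r]-sets. *)
Lemma bin_div_ge (a r n : nat) : (0 < a)%N -> (2 * a * r.+1 <= n)%N ->
  (n ^ r <= (2 * a) ^ r * (r`! * 'C(n %/ a, r)))%N.
Proof.
move=> a0 an; have hr : (n <= 2 * a * (n %/ a - r))%N.
  by have := divn_eq n a; have := ltn_pmod n a0; nia.
rewrite mulnC in hr; rewrite [(_`! * _)%N]mulnC bin_ffact.
have ffact_ge (h m : nat) : (m <= r -> (h - r) ^ m <= h ^_ m)%N.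
  elim: m => [|m IH] mr //; rewrite expnSr ffactnSr.
  exact: leq_mul (IH (ltnW mr)) (leq_sub2l _ (ltnW mr)).
apply: (@leq_trans ((2 * a) ^ r * (n %/ a - r) ^ r)); last by rewrite leq_mul2l ffact_ge ?orbT.
by rewrite -expnMn mulnC; case: (r) hr => // r' hr'; rewrite leq_exp2r.
Qed.

Lemma card_kedge (n k : nat) (P : pred {set 'I_n}) :
  #|[set e : kedge n k | P (val e)]| = #|[set e : {set 'I_n} | (#|e| == k) && P e]|.
Proof.
rewrite -[LHS](card_imset _ val_inj); apply: eq_card => e.
rewrite [RHS]inE; apply/imsetP/andP => [[e' + ->]|[ek Pe]].
  by rewrite inE => Pe; split=> //; exact: (valP e').
by exists (Sub e ek : kedge n k); rewrite ?inE ?SubK.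
Qed.

Definition violators (n k : nat) (q : int) (Y : 'I_n -> int) : {set kedge n k} :=
  [set e : kedge n k | ~~ (q %| altsum Y (val e))%Z].

Lemma card_ge_fibers (T U : finType) (A : {set T}) (D : {set U}) (f : T -> U) (m : nat) :
  (forall b, b \in D -> m <= #|[set x in A | f x == b]|)%N -> (#|D| * m <= #|A|)%N.
Proof.
move=> fib; rewrite -sum_nat_const.
apply: (@leq_trans (\sum_(b in D) #|[set x in A | f x == b]|)); first exact: leq_sum.
rewrite -[leqRHS]sum1_card (bigID (fun x => f x \in D)) /=.
apply: leq_trans (leq_addr _ _).
rewrite (partition_big f (mem D)) /=; last by move=> x /andP[].
apply: leq_sum => b bD; rewrite -sum1_card; apply: eq_leq; apply: eq_bigl => x.
by rewrite inE; case: eqP => [->|]; rewrite ?bD ?andbT ?andbF.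
Qed.

Lemma card_draws_sub (T : finType) (W : {set T}) (r : nat) :
  #|[set B : {set T} | (B \subset W) && (#|B| == r)]| = 'C(#|W|, r).
Proof. by rewrite cards_draws. Qed.

(* An edge made of a set B of r late vertices and one earlier vertex u is
   violated unless Y u is the residue determined by B. *)
Lemma card_violators_no_majority (n r g : nat) (q : int) (Y : 'I_n -> int) :
  (0 < g)%N -> (2 * g <= n)%N ->
  (forall c : int, n < g * #|[set v | ~~ (q %| (Y v - c)%R)%Z]|)%N ->
  (n * 'C(n %/ (2 * g), r) <= 4 * g * #|violators r.+1 q Y|)%N.
Proof.
move=> g0 gn nomaj; set h := (n %/ (2 * g))%N.
have hn : (2 * g * h <= n)%N by rewrite mulnC leq_trunc_div.
pose W := [set v : 'I_n | (n - h <= v)%N].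
have cardW : #|W| = h.
  have hn' : (h <= n)%N by exact: leq_div.
  have -> : W = ~: [set v : 'I_n | (v < n - h)%N] by apply/setP => v; rewrite !inE leqNgt.
  rewrite cardsCs setCK card_ord -sum1_card.
  under eq_bigl do rewrite inE.
  by rewrite (big_ord_narrow (leq_subr h n)) sum1_card card_ord subKn.
pose D := [set B : {set 'I_n} | (B \subset W) && (#|B| == r)].
pose A := [set e : {set 'I_n} | (#|e| == r.+1) && ~~ (q %| altsum Y e)%Z].
have fib (B : {set 'I_n}) : B \in D -> (n %/ (2 * g) <= #|[set e in A | e :&: W == B]|)%N.
  rewrite inE => /andP[BW Br].
  pose U := [set v | ~~ (q %| (Y v - altsum Y B)%R)%Z] :\: W.
  have UB u v : u \in U -> v \in B -> (u < v)%N.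
    rewrite inE => /andP[+ _] /(subsetP BW); rewrite !inE -ltnNge; exact: leq_trans.
  have UnB u : u \in U -> u \notin B.
    by move=> uU; apply/negP => /(UB u u uU); rewrite ltnn.
  (* More than [n / g] vertices avoid the residue, and at most [h], about half as many, are late. *)
  have : (n %/ (2 * g) <= #|U|)%N.
    rewrite /U cardsD; have := nomaj (altsum Y B); set N := #|[set v | _]|.
    have : (#|[set v | ~~ (q %| (Y v - altsum Y B)%R)%Z] :&: W| <= h)%N.
      by rewrite -cardW subset_leq_card // subsetIr.
    rewrite -/h; move: #|_ :&: _| => x; nia.
  move/leq_trans; apply.
  rewrite -(card_in_imset (f := fun u => u |: B)); last first.
    move=> u u' uU u'U /= /setP /(_ u); rewrite !inE eqxx /= (negbTE (UnB _ uU)) orbF.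
    by move/esym/eqP.
  apply/subset_leq_card/subsetP => e /imsetP[u uU ->]; rewrite !inE.
  rewrite cardsU1 (UnB _ uU) add1n eqSS Br /=.
  rewrite altsumU1; last by move=> v; exact: UB.
  have := uU; rewrite !inE => /andP[uW ->] /=.
  rewrite setIUl (setIidPl BW); apply/eqP/setUidPr/subsetP => v.
  by rewrite !inE => /andP[/eqP-> ]; rewrite (negbTE uW).
have := card_ge_fibers fib.
rewrite /D card_draws_sub cardW /violators (card_kedge _ (fun e => ~~ (q %| altsum Y e)%Z)) -/A -/h.
have : (n <= 4 * g * h)%N.
  have := divn_eq n (2 * g); have : (n %% (2 * g) < 2 * g)%N by rewrite ltn_pmod // muln_gt0.
  have : (0 < h)%N by rewrite divn_gt0 // muln_gt0.
  by rewrite -/h (_ : (4 * g = 2 * (2 * g))%N) ?mulnA //; nia.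
rewrite -/h; move: 'C(h, r) #|A| => b a.
move=> nh ba; apply: leq_trans (leq_mul nh (leqnn b)) _.
by rewrite -mulnA leq_mul2l (mulnC h) ba orbT.
Qed.

(** On an edge all of whose vertices have the majority residue [c], the alternating sum is [c]
    modulo [q], because [k] is odd. *)
Lemma card_violators_majority (n k g : nat) (q c : int) (Y : 'I_n -> int) :
  odd k -> (1 < g)%N -> ~~ (q %| c)%Z ->
  (g * #|[set v | ~~ (q %| (Y v - c)%R)%Z]| <= n)%N ->
  ('C(n %/ (2 * g), k) <= #|violators k q Y|)%N.
Proof.
move=> ok g1 qc; set N := [set v | _] => Nn.
have hN : (n %/ (2 * g) <= #|~: N|)%N.
  rewrite cardsCs setCK card_ord.
  have := leq_trunc_div n (2 * g); move: (n %/ _)%N #|N| Nn => h N0 gN hg.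
  have : (2 * N0 <= n)%N by apply: leq_trans gN; rewrite leq_mul2r g1 orbT.
  have : (4 * h <= n)%N by apply: leq_trans hg; nia.
  by lia.
apply: leq_trans (leq_bin2l k hN) _; rewrite -card_draws_sub.
rewrite /violators (card_kedge _ (fun e => ~~ (q %| altsum Y e)%Z)).
apply/subset_leq_card/subsetP => e; rewrite !inE => /andP[eN ek].
rewrite ek /=; apply: contra qc => qY.
have -> : c = altsum Y e - altsum (fun v => Y v - c) e.
  rewrite altsumB /altsum -[LHS]/(if true then c else 0) -ok -{1}(eqP ek) -altsum_const.
  by apply: eq_bigr => v _; rewrite subKr.
rewrite rpredB // dvdz_altsum // => v /(subsetP eN).
by rewrite !inE negbK.
Qed.

(** If some residue [c] is taken off at most [n / g] vertices, [spread] forces [k] to be odd, and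
    [c] to be nonzero modulo [q], since otherwise 0 would be such a residue. Hence one of the two
    preceding counts applies. *)
Lemma card_violators (k g n : nat) (q : int) (Y : 'I_n -> int) :
  (0 < k)%N -> (1 < g)%N -> (4 * g * k.+1 <= n)%N -> spread k g q Y ->
  (n ^ k <= (4 * g) ^ k * k`! * #|violators k q Y|)%N.
Proof.
case: k => // r _ g1 gn spr; have g0 : (0 < g)%N by rewrite ltnW.
have g20 : (0 < 2 * g)%N by rewrite muln_gt0.
have [nomaj|] := pselect (forall c : int, n < g * #|[set v | ~~ (q %| (Y v - c)%R)%Z]|)%N.
  have := card_violators_no_majority r g0 _ nomaj.
  have /(_ (2 * g)%N r n g20) := bin_div_ge; rewrite (_ : (2 * (2 * g) = 4 * g)%N); last by lia.
  move=> /(_ _) H1 /(_ _) H2.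
  have {}H1 := H1 (leq_trans (leq_mul (leqnn _) (leqnSn _)) gn).
  have {}H2 : (n * 'C(n %/ (2 * g), r) <= 4 * g * #|violators r.+1 q Y|)%N.
    by apply: H2; apply: leq_trans gn; nia.
  rewrite !expnS factS; apply: leq_trans (leq_mul (leqnn n) H1) _.
  move: ('C(_, r)) (#|_|) H2 ((4 * g) ^ r)%N r`! => b a ba x f.
  apply: (@leq_trans (x * f * (n * b))); first by apply: eq_leq; ring.
  apply: leq_trans (leq_mul (leqnn _) ba) _.
  apply: (@leq_trans (4 * g * x * (1 * f) * a)); first by apply: eq_leq; ring.
  by rewrite leq_mul2r leq_mul ?orbT // leq_mul2r orbT.
move=> /existsNP[c /negP]; rewrite -leqNgt => maj.
have ok : odd r.+1.
  by apply: contraT => ek; have := spr c; rewrite ltnNge maj =>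
    /(_ (fun ok => False_ind _ (negP ek ok))).
have qc : ~~ (q %| c)%Z.
  apply/negP => qc; have := spr 0 (fun=> erefl); rewrite ltnNge => /negP; apply.
  apply: leq_trans maj; rewrite leq_mul2l subset_leq_card ?orbT //.
  apply/subsetP => v; rewrite !inE subr0; apply: contra => qY.
  by rewrite -(subrK c (Y v)) rpredD.
have H := card_violators_majority ok g1 qc maj.
have /(_ (2 * g)%N r.+1 n g20) := bin_div_ge; rewrite (_ : (2 * (2 * g) = 4 * g)%N); last by lia.
move=> /(_ gn) H1; apply: leq_trans H1 _.
by rewrite -mulnA leq_mul2l leq_mul2l H !orbT.
Qed.

(** * Fingerprints of unsettled hypergraphs *)

Definition edge_vec (n k : nat) (e : kedge n k) : 'cV[int]_n :=
  \col_v (if v \in val e then (-1) ^+ (vpos (val e) v).+1 else 0).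

Lemma mul_edge_vec (n k : nat) (Y : 'rV[int]_n) (e : kedge n k) :
  (Y *m edge_vec e) ord0 ord0 = altsum (fun v => Y ord0 v) (val e).
Proof.
rewrite mxE /altsum [RHS]big_mkcond; apply: eq_bigr => v _.
by rewrite mxE; case: ifP; rewrite ?mulr0 // mulrC.
Qed.

Definition unsettled (n k g : nat) (H : {set kedge n k}) : Prop :=
  exists (q : int) (Y : 'I_n -> int), kills q Y H /\ spread k g q Y.

(** [V T] is the set of violators of a certificate chosen from [T] alone. With [T] the edges of a
    longest chain in [H], an edge of [H] in [V T] would prolong the chain, the chosen certificate
    being its witness. *)
Lemma exists_fingerprint (n k g : nat) :
  exists V : {set kedge n k} -> {set kedge n k},
    (forall T, unsettled g T -> exists (q : int) (Y : 'I_n -> int),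
       [/\ kills q Y T, spread k g q Y & V T = violators k q Y]) /\
    (forall H, unsettled g H -> exists T : {set kedge n k},
       [/\ T \subset H, (#|T| <= k.+1 * n)%N, unsettled g T & [disjoint H & V T]]).
Proof.
have /choice[V VP] (T : {set kedge n k}) : exists VT : {set kedge n k},
    unsettled g T -> exists (q : int) (Y : 'I_n -> int),
      [/\ kills q Y T, spread k g q Y & VT = violators k q Y].
  have [[q [Y [kY sY]]]|noT] := pselect (unsettled g T); last by exists set0 => /noT.
  by exists (violators k q Y) => _; exists q, Y.
exists V; split=> // H [q0 [Y0 [kY0 sY0]]].
pose Q m := `[< exists s : seq (kedge n k),
  [/\ {subset s <= H}, independent_chain (map (@edge_vec n k) s) & size s = m] >].
have Q0 : exists m, Q m by exists 0%N; apply/asboolP; exists [::].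
have Qle m : Q m -> (m <= k.+1 * n)%N.
  move=> /asboolP[s [sH chs <-]]; rewrite -(size_map (@edge_vec n k)).
  apply: size_independent_chain => // x /mapP[e _ ->].
  rewrite (bigID (mem (val e))) /= [X in _ + X]big1 ?addr0; last first.
    by move=> v /negbTE ve; rewrite mxE ve normr0.
  have -> : k%:R = #|val e|%:R :> int by rewrite (eqP (valP e)).
  rewrite -sum1_card natr_sum ler_sum // => v ve.
  by rewrite mxE ve normrX normrN1 expr1n.
case: (ex_maxnP Q0 Qle) => m /asboolP[s [sH chs sm]] maxm.
pose T := [set e in s].
have uT : unsettled g T.
  by exists q0, Y0; split=> // e; rewrite inE => /sH; exact: kY0.
exists T; split=> //.
- by apply/subsetP => e; rewrite inE => /sH.
- apply: leq_trans (Qle _ (asboolT (ex_intro _ s (And3 sH chs sm)))).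
  by rewrite -sm cardsE card_size.
have [q [Y [kY sY ->]]] := VP T uT.
rewrite disjoint_subset; apply/subsetP => e eH; rewrite !inE negbK.
apply: contraT => qe; have : Q m.+1.
  apply/asboolP; exists (e :: s); split=> /=; last by rewrite sm.
    by move=> e'; rewrite inE => /predU1P[->|/sH].
  split=> //; exists q, (\row_v Y v).
  have E e' : (\row_v Y v *m edge_vec e') ord0 ord0 = altsum Y (val (e' : kedge n k)).
    by rewrite mul_edge_vec; apply: eq_bigr => v _; rewrite mxE.
  split; last by rewrite E.
  by move=> _ /mapP[e' e's ->]; rewrite E kY // inE.
by move/maxm; rewrite ltnn.
Qed.


(** * Edges with a prescribed number of vertices in a set *)

Definition trace_edges (n k : nat) (S : {set 'I_n}) (j : nat) : {set kedge n k} :=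
  [set e : kedge n k | #|val e :&: S| == j].

Lemma bin_le_exp (m r : nat) : ('C(m, r) <= m ^ r)%N.
Proof.
have ffact_le : (m ^_ r <= m ^ r)%N.
  elim: r => // r IH; rewrite ffactnSr expnSr; exact: leq_mul IH (leq_subr _ _).
by apply: leq_trans ffact_le; rewrite -bin_ffact leq_pmulr ?fact_gt0.
Qed.

Lemma card_trace_le (n k j : nat) (S : {set 'I_n}) : (j <= k)%N ->
  (#|trace_edges k S j| <= #|S| ^ j * n ^ (k - j))%N.
Proof.
move=> jk; rewrite /trace_edges (card_kedge _ (fun e => #|e :&: S| == j)).
set A := [set e | _].
pose D := setX [set B : {set 'I_n} | (B \subset S) && (#|B| == j)]
               [set B : {set 'I_n} | (B \subset [set: 'I_n]) && (#|B| == k - j)%N].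
have : (#|D| <= #|S| ^ j * n ^ (k - j))%N.
  by rewrite cardsX !card_draws_sub leq_mul ?bin_le_exp // cardsT card_ord bin_le_exp.
apply: leq_trans; rewrite -(card_imset A (f := fun e => (e :&: S, e :\: S))); last first.
  by move=> e e' [eS eD]; rewrite -(setID e S) eS eD setID.
apply/subset_leq_card/subsetP => _ /imsetP[e + ->]; rewrite !inE => /andP[/eqP ek /eqP ej].
by rewrite subsetIr ej eqxx subsetT /= cardsD ek ej.
Qed.

Lemma card_trace1_ge (n r : nat) (S : {set 'I_n}) : (2 * #|S| <= n)%N ->
  (#|S| * 'C(n %/ 2, r) <= #|trace_edges r.+1 S 1|)%N.
Proof.
move=> Sn; rewrite /trace_edges (card_kedge _ (fun e => #|e :&: S| == 1%N)).
set A := [set e | _].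
pose D := [set B : {set 'I_n} | (B \subset ~: S) && (#|B| == r)].
have fib B : B \in D -> (#|S| <= #|[set e in A | e :\: S == B]|)%N.
  rewrite inE => /andP[BS Br].
  have SnB u : u \in S -> u \notin B.
    by move=> uS; apply/negP => /(subsetP BS); rewrite inE uS.
  rewrite -(card_in_imset (f := fun u => u |: B)); last first.
    move=> u u' uS u'S /= /setP /(_ u); rewrite !inE eqxx /= (negbTE (SnB _ uS)) orbF.
    by move/esym/eqP.
  have BS0 : B :&: S = set0 by apply/eqP; rewrite setI_eq0 disjoints_subset.
  apply/subset_leq_card/subsetP => e /imsetP[u uS ->]; rewrite !inE.
  rewrite cardsU1 (SnB _ uS) add1n eqSS Br /= setIUl BS0 setU0.
  rewrite (setIidPl _) ?sub1set // cards1 eqxx /=.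
  rewrite setDUl (_ : [set u] :\: S = set0) ?set0U; last by apply/eqP; rewrite setD_eq0 sub1set.
  by apply/eqP/setDidPl; rewrite -setI_eq0 BS0.
apply: leq_trans (card_ge_fibers fib); rewrite card_draws_sub mulnC leq_mul2r leq_bin2l ?orbT //.
rewrite cardsCs setCK card_ord; have := divn_eq n 2; lia.
Qed.

(** * Probability bounds *)

Section Probability.
Variables (R : realType) (n k : nat) (p : R).
Hypothesis p01 : 0 <= p <= 1.

(** Independence of the edges: the expectation of a product over edges factorizes. *)
Lemma Hknp_expect_prod (a b : kedge n k -> R) :
  \sum_(H : hypergraph n k) Hknp_mass p H * \prod_e (if e \in H then a e else b e) =
  \prod_e (p * a e + (1 - p) * b e).
Proof.
rewrite bigA_distr; apply: eq_bigr => H _; rewrite -big_split /=.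
by apply: eq_bigr => e _; case: ifP.
Qed.

Lemma Hknp_prob_markov (E : hypergraph n k -> Prop) (X : hypergraph n k -> R) :
  (forall H, 0 <= X H) -> (forall H, E H -> 1 <= X H) ->
  Hknp_prob n k p E <= \sum_(H : hypergraph n k) Hknp_mass p H * X H.
Proof.
move=> X0 X1; rewrite /Hknp_prob [leRHS](bigID (fun H => `[< E H >])) /=.
rewrite -[leLHS]addr0 lerD ?sumr_ge0 // => [|H _]; last by rewrite mulr_ge0 ?Hknp_mass_ge0.
apply: ler_sum => H /asboolP EH.
by rewrite -[leLHS]mulr1 ler_wpM2l ?Hknp_mass_ge0 // X1.
Qed.

Lemma Hknp_probC (E : hypergraph n k -> Prop) :
  Hknp_prob n k p E = 1 - Hknp_prob n k p (fun H => ~ E H).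
Proof.
rewrite -(Hknp_mass_sum1 n k p) /Hknp_prob [X in _ = X - _](bigID (fun H => `[< E H >])) /=.
rewrite (eq_bigl (fun H => ~~ `[< E H >]) _ (fun H => asbool_neg)).
by rewrite addrK.
Qed.

Lemma Hknp_prob_le_or (E E1 E2 : hypergraph n k -> Prop) :
  (forall H, E H -> E1 H \/ E2 H) ->
  Hknp_prob n k p E <= Hknp_prob n k p E1 + Hknp_prob n k p E2.
Proof.
move=> E12; rewrite /Hknp_prob big_mkcond [X in X + _]big_mkcond [X in _ + X]big_mkcond.
rewrite -big_split /= ler_sum // => H _; have m0 := Hknp_mass_ge0 H p01.
case: asboolP => [/E12 [EH|EH]|_]; first by rewrite (asboolT EH) lerDl; case: ifP.
  by rewrite (asboolT EH) lerDr; case: ifP.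
by rewrite addr_ge0 //; case: ifP.
Qed.

Lemma prod_le_expR (I : finType) (A : pred I) (x : I -> R) :
  (forall i, A i -> 0 <= 1 + x i) -> \prod_(i | A i) (1 + x i) <= expR (\sum_(i | A i) x i).
Proof.
move=> x0; rewrite expR_sum; apply: ler_prod => i Ai; rewrite x0 //=; exact: expR_ge1Dx.
Qed.

Lemma card_kedges : #|kedge n k| = 'C(n, k).
Proof.
have := card_kedge k (fun _ : {set 'I_n} => true).
rewrite (_ : [set e : kedge n k | _] = setT) ?cardsT => [->|];
  last by apply/setP => e; rewrite !inE.
rewrite -[n in RHS]card_ord -cardsT -card_draws_sub; apply: eq_card => e.
by rewrite !inE subsetT andbT.
Qed.

(* Union bound over T, where 1 <= l ^ (m - #|T|) gives a sum over all T that
   factorizes. *)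
Lemma prob_fingerprint (m : nat) (v l : R) (U : hypergraph n k -> Prop)
    (V : {set kedge n k} -> {set kedge n k}) :
  1 <= l ->
  (forall T, U T -> [disjoint T & V T] /\ v <= #|V T|%:R) ->
  (forall H, U H -> exists T : {set kedge n k},
     [/\ T \subset H, (#|T| <= m)%N, U T & [disjoint H & V T]]) ->
  Hknp_prob n k p U <= l ^+ m * expR (p * (n ^ k)%:R / l - p * v).
Proof.
move=> l1 VP fp; have l0 : 0 < l by exact: lt_le_trans l1.
have [p0 p1] := andP p01.
pose good (T : {set kedge n k}) := (#|T| <= m)%N && `[< U T >].
pose X (H : hypergraph n k) : R :=
  (* The product is the indicator of [T] being contained in [H] and [V T] disjoint from [H]. *)
  \sum_(T | good T) \prod_e (if e \in H then (e \notin V T)%:R else (e \notin T)%:R).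
have X0 H : 0 <= X H.
  by apply: sumr_ge0 => T _; apply: prodr_ge0 => e _; case: ifP; rewrite ler0n.
apply: (le_trans (Hknp_prob_markov X0 _)).
  move=> H /fp[T [TH Tm UT HV]]; rewrite /X (bigD1 T) /=; last by rewrite /good Tm; apply/asboolP.
  rewrite big1 => [|e _].
    by rewrite lerDl sumr_ge0 // => T' _; apply: prodr_ge0 => e _; case: ifP.
  case: ifPn => eH; first by rewrite (disjointFr HV eH).
  by rewrite (contra (subsetP TH e) eH).
under eq_bigr do rewrite mulr_sumr.
rewrite exchange_big /=; under eq_bigr do rewrite Hknp_expect_prod.
have termle (T : {set kedge n k}) : good T ->
    \prod_e (p * (e \notin V T)%:R + (1 - p) * (e \notin T)%:R) <=
    l ^+ m * expR (- (p * v)) * \prod_e (if e \in T then p / l else 1).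
  move=> /andP[Tm /asboolP/VP[TV Vv]].
  have -> : \prod_e (p * (e \notin V T)%:R + (1 - p) * (e \notin T)%:R) =
      (\prod_(e in V T) (1 - p)) * (\prod_(e in T) p).
    rewrite [X in _ = X * _]big_mkcond [X in _ = _ * X]big_mkcond -big_split.
    apply: eq_bigr => e _ /=; case: (boolP (e \in T)) => eT /=.
      by rewrite (disjointFr TV eT) mulr0 addr0 mulr1 mul1r.
    by rewrite mulr1; case: (e \in V T); rewrite /= ?mulr0 ?add0r ?mulr1 // addrC subrK.
  rewrite -[X in _ <= _ * X]big_mkcond /= !prodr_const expr_div_n.
  have H1 : (1 - p) ^+ #|V T| <= expR (- (p * v)).
    rewrite -[_ ^+ _]prodr_const; apply: le_trans (prod_le_expR _) _.
      by move=> e _; rewrite subr_ge0.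
    by rewrite sumr_const ler_expR mulNrn lerN2 -[leRHS]mulr_natr ler_wpM2l.
  have H2 : p ^+ #|T| <= l ^+ m * (p ^+ #|T| / l ^+ #|T|).
    rewrite mulrCA -[leLHS]mulr1 ler_wpM2l ?exprn_ge0 //.
    by rewrite ler_pdivlMr ?exprn_gt0 // mul1r ler_weXn2l.
  rewrite [X in _ <= X * _]mulrC -mulrA.
  by apply: ler_pM; rewrite ?exprn_ge0 ?subr_ge0.
apply: le_trans (ler_sum _ termle) _.
rewrite -mulr_sumr expRD [X in _ <= _ * X]mulrC mulrA.
apply: ler_wpM2l; first by rewrite mulr_ge0 ?expR_ge0 // exprn_ge0 // ltW.
(* Extended from the good [T] to all [T], the sum of [(p / l) ^+ #|T|] is this product. *)
apply: (@le_trans _ _ (\prod_(e : kedge n k) (1 + p / l))).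
  rewrite [leRHS](_ : _ = \prod_(e : kedge n k) (p / l + 1)); last first.
    by apply: eq_bigr => e _; rewrite addrC.
  rewrite bigA_distr [leRHS](bigID good) /= lerDl sumr_ge0 // => T _.
  by apply: prodr_ge0 => e _; case: ifP; rewrite // divr_ge0 // ltW.
apply: le_trans (prod_le_expR _) _.
  by move=> e _; rewrite addr_ge0 // divr_ge0 // ltW.
rewrite ler_expR sumr_const card_kedges [leRHS]mulrAC -[leLHS]mulr_natr.
by rewrite ler_wpM2l ?divr_ge0 ?(ltW l0) // ler_nat bin_le_exp.
Qed.
End Probability.


(** * Tail bounds for the two exceptional events *)

Section Tails.
Variable R : realType.

Lemma prob_unsettled_le (k g : nat) : (0 < k)%N -> (1 < g)%N ->
  exists A c : R, 0 < c /\ forall (n : nat) (p : R), (4 * g * k.+1 <= n)%N -> 0 <= p <= 1 ->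
    Hknp_prob n k p (unsettled g) <= expR (n%:R * (A - c * (p * n%:R ^+ (k - 1)))).
Proof.
move=> k0 g1; have [K KE] : exists K, K = ((4 * g) ^ k * k`!)%N by eexists.
have K0 : (0 < K)%N by rewrite KE muln_gt0 expn_gt0 fact_gt0 muln_gt0 (ltnW g1).
have KR : 0 < K%:R :> R by rewrite ltr0n.
(* Every [V T] has at least [n ^ k / K] edges. Taking [l = 2 * K] in the union bound makes the gain
   [p * n ^ k / l] half of the loss, and [l <= expR l] turns [l ^+ (k.+1 * n)] into the term with
   [A]. *)
exists ((2 * K * k.+1)%:R), ((2 * K)%:R^-1); split; first by rewrite invr_gt0 ltr0n muln_gt0.
move=> n p gn p01; have [V [VP fp]] := exists_fingerprint n k g.
apply: le_trans (@prob_fingerprint R n k p p01 (k.+1 * n) (n%:R ^+ k / K%:R) (2 * K)%:R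
    (unsettled g) V _ _ fp) _.
- by rewrite ler1n muln_gt0.
- move=> T /VP[q [Y [kY sY ->]]]; split.
    rewrite disjoint_subset; apply/subsetP => e eT.
    by rewrite !inE negbK; exact: kY.
  rewrite ler_pdivrMr // -natrX -natrM ler_nat mulnC.
  by rewrite KE; exact: card_violators.
have -> : n%:R * ((2 * K * k.+1)%:R - (2 * K)%:R^-1 * (p * n%:R ^+ (k - 1))) =
    (2 * K)%:R * (k.+1 * n)%:R + (p * (n ^ k)%:R / (2 * K)%:R - p * (n%:R ^+ k / K%:R)) :> R.
  rewrite natrX (_ : n%:R ^+ k = n%:R * n%:R ^+ (k - 1) :> R); last first.
    by rewrite -exprS subn1 prednK.
  by rewrite !natrM; field; rewrite lt0r_neq0.
rewrite [leRHS]expRD ler_wpM2r ?expR_ge0 //.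
rewrite expRM_natr; apply: lerXn2r; rewrite ?nnegrE ?expR_ge0 ?ler0n //.
by apply: le_trans (expR_ge1Dx _); rewrite lerDr.
Qed.

(* mu = n / (g #|S|) is chosen so that edges meeting S in i > 1 vertices have total
   weight at most #|S| n^r / g, and g so that the single intersections win. *)
Lemma sum_trace_weight (n r g K : nat) (S : {set 'I_n}) (mu : R) :
  (0 < K)%N -> g = (2 * r.+2 * K)%N -> S != set0 -> (g * #|S| <= n)%N ->
  (n ^ r <= K * 'C(n %/ 2, r))%N -> mu = n%:R / (g * #|S|)%:R ->
  \sum_(e : kedge n r.+1) ((if #|val e :&: S| == 1%N then 0 else mu ^+ #|val e :&: S|.-1) - 1)
    <= - (#|S|%:R * n%:R ^+ r / (2 * K)%:R).
Proof.
move=> K0 gE S0 gS nK muE; set s := #|S| in gS muE *.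
have s0 : (0 < s)%N by rewrite card_gt0.
have g0 : (0 < g)%N by rewrite gE !muln_gt0 K0.
have gs0 : (0 < g * s)%N by rewrite muln_gt0 g0.
have n0 : (0 < n)%N by exact: leq_trans gS.
have mu1 : 1 <= mu by rewrite muE ler_pdivlMr ?ltr0n // mul1r ler_nat.
pose t (e : kedge n r.+1) := #|val e :&: S|.
have tk e : (t e < r.+2)%N.
  by rewrite ltnS -[leqRHS](eqP (valP e)) subset_leq_card // subsetIl.
apply: (@le_trans _ _ (\sum_(e : kedge n r.+1)
    (- (t e == 1)%:R + \sum_(i < r.+2 | (1 < i)%N) (t e == i)%:R * mu ^+ i.-1))).
  apply: ler_sum => e _; rewrite -/(t e).
  (* An edge missing [S] has weight [mu ^+ 0 - 1 = 0], as the predecessor of 0 is 0; a single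
     intersection contributes -1; otherwise the -1 is dropped. *)
  case: (ltngtP (t e) 1%N) => [| t1 | ->].
  - case: (t e) => // _; rewrite expr0 subrr /= oppr0 add0r sumr_ge0 // => i _.
    by rewrite mulr_ge0 // exprn_ge0 // (le_trans ler01).
  - rewrite oppr0 add0r (bigD1 (Ordinal (tk e))) //= eqxx mul1r lerD //.
    rewrite (@le_trans _ _ 0) // ?oppr_le0 // sumr_ge0 // => i _.
    by rewrite mulr_ge0 // exprn_ge0 // (le_trans ler01).
  - rewrite sub0r lerDl sumr_ge0 // => i _.
    by rewrite mulr_ge0 // exprn_ge0 // (le_trans ler01).
rewrite big_split /= sumrN exchange_big /=.
have countE (i : nat) : \sum_(e : kedge n r.+1) (t e == i)%:R = #|trace_edges r.+1 S i|%:R :> R.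
  rewrite -natr_sum -sum1_card [in RHS]big_mkcond /=; congr _%:R.
  by apply: eq_bigr => e _; rewrite inE -/(t e); case: eqP.
have N1 : (s%:R : R) * n%:R ^+ r / K%:R <= \sum_(e : kedge n r.+1) (t e == 1%N)%:R.
  rewrite countE ler_pdivrMr ?ltr0n // -natrX -!natrM ler_nat.
  apply: leq_trans (leq_mul (card_trace1_ge r (S := S) _) (leqnn K)); last first.
    by apply: leq_trans gS; rewrite leq_mul2r gE -!mulnA leq_pmulr ?orbT // !muln_gt0 K0.
  by rewrite -mulnA leq_mul2l mulnC nK orbT.
(* The count [s ^ i * n ^ (r.+1 - i)] times [mu ^+ i.-1] equals [s * n ^ r / g ^ i.-1]. *)
have Ni (i : 'I_r.+2) : (1 < i)%N -> \sum_(e : kedge n r.+1) (t e == i)%:R * mu ^+ i.-1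
     <= (s%:R : R) * n%:R ^+ r / g%:R.
  move=> i1; rewrite -mulr_suml countE.
  have ir : (i <= r.+1)%N by rewrite -ltnS.
  apply: (@le_trans _ _ ((s ^ i * n ^ (r.+1 - i))%:R * mu ^+ i.-1)).
    by rewrite ler_wpM2r ?ler_nat ?card_trace_le // exprn_ge0 // (le_trans ler01).
  case: (nat_of_ord i) i1 ir => [|[|j]] // _ jr; rewrite /= subSS.
  have gj : g%:R <= g%:R ^+ j.+1 :> R.
    by rewrite -natrX ler_nat -[leqLHS]expn1 leq_pexp2l.
  have sR : s%:R != 0 :> R by rewrite pnatr_eq0 -lt0n.
  have gR : g%:R != 0 :> R by rewrite pnatr_eq0 -lt0n.
  have -> : (s ^ j.+2 * n ^ (r - j.+1))%:R * mu ^+ j.+1 = s%:R * n%:R ^+ r / g%:R ^+ j.+1.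
    rewrite muE natrM natrM !natrX expr_div_n exprMn.
    rewrite -[X in _ = _ * n%:R ^+ X / _](subnK (jr : (j.+1 <= r)%N)) exprD exprS.
    by field; rewrite !expf_neq0.
  rewrite ler_wpM2l ?mulr_ge0 ?exprn_ge0 // lef_pV2 ?posrE ?exprn_gt0 ?ltr0n //.
(* There are at most [r.+2] values of [i], so by the choice of [g] they use up only half of the
   bound for single intersections. *)
have sum2 : \sum_(i < r.+2 | (1 < i)%N) \sum_(e : kedge n r.+1) (t e == i)%:R * mu ^+ i.-1
     <= (s%:R : R) * n%:R ^+ r / (2 * K)%:R.
  apply: le_trans (ler_sum _ Ni) _; rewrite big_mkcond /=.
  apply: (@le_trans _ _ (\sum_(i < r.+2) s%:R * n%:R ^+ r / g%:R)).
    apply: ler_sum => i _; case: ifP => // _.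
  rewrite sumr_const card_ord -mulr_natr gE !natrM le_eqVlt; apply/orP; left; apply/eqP.
  by field; rewrite -natrD !pnatr_eq0 -lt0n K0.
have := lerB sum2 N1; rewrite addrC => /le_trans; apply.
rewrite natrM le_eqVlt; apply/orP; left; apply/eqP.
by field; rewrite pnatr_eq0 -lt0n.
Qed.

Lemma prob_trace_le (n r g K : nat) (S : {set 'I_n}) (p : R) :
  0 <= p <= 1 -> (0 < K)%N -> g = (2 * r.+2 * K)%N -> S != set0 -> (g * #|S| <= n)%N ->
  (n ^ r <= K * 'C(n %/ 2, r))%N ->
  Hknp_prob n r.+1 p (fun H => (forall e, e \in H -> #|val e :&: S| != 1%N) /\
      (#|S| <= \sum_(e in H) #|val e :&: S|.-1)%N)
    <= ((g * #|S|)%:R / n%:R * expR (- (p * n%:R ^+ r / (2 * K)%:R))) ^+ #|S|.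
Proof.
move=> p01 K0 gE S0 gS nK; have [p0 p1] := andP p01.
have s0 : (0 < #|S|)%N by rewrite card_gt0.
have g0 : (0 < g)%N by rewrite gE !muln_gt0 K0.
have gs0 : (0 < g * #|S|)%N by rewrite muln_gt0 g0.
have n0 : (0 < n)%N by exact: leq_trans gS.
pose mu : R := n%:R / (g * #|S|)%:R.
have mu1 : 1 <= mu by rewrite ler_pdivlMr ?ltr0n // mul1r ler_nat.
have mu0 : 0 < mu by exact: lt_le_trans mu1.
(* Exponential Markov bound; the weight 0 accounts for the event that no edge
   meets S in one vertex. *)
pose w (e : kedge n r.+1) : R :=
  if #|val e :&: S| == 1%N then 0 else mu ^+ #|val e :&: S|.-1.
have w0 e : 0 <= w e by rewrite /w; case: ifP => // _; rewrite exprn_ge0 // ltW.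
pose X (H : hypergraph n r.+1) := mu ^- #|S| * \prod_e (if e \in H then w e else 1).
apply: (le_trans (Hknp_prob_markov p01 (X := X) _ _)).
- move=> H; rewrite mulr_ge0 ?invr_ge0 ?exprn_ge0 ?(ltW mu0) //.
  by apply: prodr_ge0 => e _; case: ifP.
- move=> H [no1 big]; rewrite /X mulrC ler_pdivlMr ?exprn_gt0 // mul1r.
  rewrite -big_mkcond /= (eq_bigr (fun e => mu ^+ #|val e :&: S|.-1)).
    by rewrite -expr_sum ler_weXn2l.
  by move=> e /no1 /negbTE ej; rewrite /w ej.
rewrite /X; under eq_bigr do rewrite mulrCA.
rewrite -mulr_sumr Hknp_expect_prod.
have -> : (g * #|S|)%:R / n%:R = mu^-1 by rewrite invf_div.
rewrite [leRHS]exprMn exprVn ler_wpM2l ?invr_ge0 ?exprn_ge0 ?(ltW mu0) //.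
have -> : \prod_e (p * w e + (1 - p) * 1) = \prod_e (1 + p * (w e - 1)).
  by apply: eq_bigr => e _; ring.
apply: le_trans (prod_le_expR _) _.
  move=> e _; rewrite [leRHS](_ : _ = p * w e + (1 - p)); last by ring.
  by rewrite addr_ge0 ?subr_ge0 // mulr_ge0.
rewrite -mulr_sumr -expRM_natl ler_expR mulrN.
have := sum_trace_weight K0 gE S0 gS nK (erefl mu).
move=> /(ler_wpM2l p0) /le_trans; apply.
by rewrite mulrN lerN2 le_eqVlt; apply/orP; left; apply/eqP; ring.
Qed.

(** The left side is one term of the binomial expansion of [(1 + s / n) ^ n]. *)
Lemma bin_exp_le (n s : nat) : (0 < n)%N ->
  'C(n, s)%:R * (s%:R / n%:R) ^+ s <= expR s%:R :> R.
Proof.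
move=> n0; have [sn|ns] := leqP s n; last by rewrite bin_small // mul0r expR_ge0.
set x : R := s%:R / n%:R; have x0 : 0 <= x by rewrite divr_ge0.
apply: (@le_trans _ _ ((1 + x) ^+ n)).
  rewrite exprDn (bigD1 (Ordinal (sn : (s < n.+1)%N))) //= expr1n mul1r mulr_natl lerDl.
  by apply: sumr_ge0 => i _; rewrite expr1n mul1r mulrn_wge0 // exprn_ge0.
have -> : s%:R = n%:R * x by rewrite /x mulrCA mulfV ?mulr1 // pnatr_eq0 -lt0n.
by rewrite expRM_natl lerXn2r ?nnegrE ?expR_ge0 ?addr_ge0 // expR_ge1Dx.
Qed.

Lemma sum_exp_le (z : R) (m : nat) : 0 <= z -> z <= 2^-1 ->
  \sum_(1 <= s < m.+1) z ^+ s <= 2 * z.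
Proof.
move=> z0 z2; suff : \sum_(1 <= s < m.+1) z ^+ s <= 2 * z - 2 * z ^+ m.+1.
  by move/le_trans; apply; rewrite gerBl mulr_ge0 // exprn_ge0.
elim: m => [|m IH]; first by rewrite big_geq // expr1 subrr.
rewrite big_nat_recr //= [z ^+ m.+2]exprS.
have : 0 <= z ^+ m.+1 by rewrite exprn_ge0.
by move: IH; set a := z ^+ m.+1; nra.
Qed.

(** Union bound over small sets. In the exponent of [z], the summand [g] absorbs the factor [g ^ s]
    for sets of size [s], and the summand 1 leaves [expR (- s)], which pays for the ['C(n, s)] sets
    of this size. A geometric series in [z] remains. *)
Lemma prob_not_sparse_le (n r g K : nat) (p : R) :
  0 <= p <= 1 -> (0 < K)%N -> g = (2 * r.+2 * K)%N -> (0 < n)%N ->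
  (n ^ r <= K * 'C(n %/ 2, r))%N ->
  let z := expR ((1 + g)%:R - p * n%:R ^+ r / (2 * K)%:R) in
  z <= 2^-1 ->
  Hknp_prob n r.+1 p (fun H => ~ locally_sparse g H) <= 2 * z.
Proof.
move=> p01 K0 gE n0 nK z z2.
pose bad (S : {set 'I_n}) (H : hypergraph n r.+1) := (forall e, e \in H -> #|val e :&: S| != 1%N) /\
      (#|S| <= \sum_(e in H) #|val e :&: S|.-1)%N.
pose small (S : {set 'I_n}) := (S != set0) && (g * #|S| <= n)%N.
apply: (@le_trans _ _ (\sum_(S | small S) Hknp_prob n r.+1 p (bad S))).
  pose X (H : hypergraph n r.+1) : R := \sum_(S | small S) (`[< bad S H >])%:R.
  apply: (le_trans (Hknp_prob_markov p01 (X := X) _ _)).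
  - by move=> H; apply: sumr_ge0.
  - move=> H /existsNP[S /not_implyP[S0 /not_implyP[gS /not_implyP[no1 /negP]]]].
    rewrite -leqNgt => big; rewrite /X (bigD1 S) /=; last by rewrite /small S0.
    by rewrite asboolT // lerDl sumr_ge0.
  under eq_bigr do rewrite mulr_sumr.
  rewrite exchange_big /=; apply: ler_sum => S _.
  rewrite /Hknp_prob [leRHS]big_mkcond; apply: ler_sum => H _.
  by case: asboolP => _; rewrite ?mulr1 ?mulr0.
have termle S : small S -> Hknp_prob n r.+1 p (bad S) <=
    (#|S|%:R / n%:R) ^+ #|S| * expR (- #|S|%:R) * z ^+ #|S|.
  move=> /andP[S0 gS]; apply: le_trans (prob_trace_le p01 K0 gE S0 gS nK) _.
  have -> : expR (- #|S|%:R) = expR (-1) ^+ #|S| :> R by rewrite -expRM_natl mulrN1.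
  rewrite -!exprMn lerXn2r ?nnegrE ?mulr_ge0 ?expR_ge0 ?invr_ge0 //.
  rewrite natrM [X in X / _]mulrC -[X in X * _]mulrA [X in _ * X * _]mulrC mulrA -mulrA.
  rewrite -[leRHS]mulrA ler_wpM2l ?divr_ge0 //.
  rewrite /z natrD -addrA expRD mulrA -expRD addNr expR0 mul1r expRD.
  by rewrite ler_wpM2r ?expR_ge0 // (le_trans _ (expR_ge1Dx _)) // lerDr.
apply: le_trans (ler_sum _ termle) _.
apply: le_trans (sum_exp_le n (expR_ge0 _) z2).
pose h s := (s%:R / n%:R) ^+ s * expR (- s%:R) * z ^+ s : R.
have h0 s : 0 <= h s.
  by rewrite !mulr_ge0 ?expR_ge0 ?exprn_ge0 ?expR_ge0 // divr_ge0.
apply: (@le_trans _ _ (\sum_(1 <= s < n.+1) 'C(n, s)%:R * h s)); last first.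
  apply: ler_sum => s _; rewrite /h !mulrA -[leRHS]mul1r ler_wpM2r ?exprn_ge0 ?expR_ge0 //.
  by rewrite expRN ler_pdivrMr ?expR_gt0 // mul1r bin_exp_le.
rewrite (big_nat_widenl 1 0) // big_mkord /=.
have cardS (S : {set 'I_n}) : (#|S| < n.+1)%N by rewrite ltnS -[leqRHS]card_ord max_card.
rewrite (partition_big (fun S : {set 'I_n} => Ordinal (cardS S)) (fun s : 'I_n.+1 => 0 < s)%N) /=;
  last by move=> S /andP[S0 _]; rewrite card_gt0.
apply: ler_sum => s _.
apply: (@le_trans _ _ (\sum_(S : {set 'I_n} | #|S| == s) h s)).
  rewrite [leLHS]big_mkcond [leRHS]big_mkcond; apply: ler_sum => S _.
  have [<-|] := eqVneq (Ordinal (cardS S)) s; last by rewrite andbF; case: ifP.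
  by rewrite andbT /= eqxx; case: ifP.
rewrite sumr_const mulr_natl ler_wpMn2l // -[X in 'C(X, _)]card_ord -card_draws.
by apply: eq_leq; apply: eq_card => S; rewrite !inE.
Qed.

End Tails.


(** * Convergence of the probability to 1 *)

Local Open Scope classical_set_scope.

Theorem theorem1p2 (R : realType) (k : nat) (p : nat -> R)
    (hk : (3 <= k)%N)
    (hp01 : forall n : nat, 0 <= p n <= 1)
    (hp : p n * n%:R ^+ (k - 1) @[n --> \oo] --> +oo) :
  Hknp_prob n k (p n)
      (fun H : hypergraph n k => torsion_free (coker (incidence H)))
    @[n --> \oo] --> (1 : R).
Proof.
case: k hk hp => [//|r] _ hp.
have [K KE] : exists K, K = ((2 * 2) ^ r * r`!)%N by eexists.
have K0 : (0 < K)%N by rewrite KE muln_gt0 expn_gt0 fact_gt0.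
have [g gE] : exists g, g = (2 * r.+2 * K)%N by eexists.
have g1 : (1 < g)%N by rewrite gE; nia.
have [A [c [c0 unsP]]] := prob_unsettled_le R (ltn0Sn r) g1.
apply/cvgrPdist_lt => eps eps0.
(* Since [expR L >= 1 + L], this makes [expR (- L)] at most both [eps / 4] and 1/2. Once both
   exponents are below [- L], the exceptional events cost [eps / 4] and [2 * (eps / 4)], less than
   [eps] in total. *)
pose L : R := 1 + 4 / eps.
have expL : expR (- L) <= eps / 4 /\ expR (- L) <= 2^-1.
  have L1 : 1 <= L by rewrite lerDl divr_ge0 // ltW.
  have := expR_ge1Dx L; rewrite expRN => le.
  have inv a : 0 < a -> a^-1 <= expR L -> (expR L)^-1 <= a.
    by move=> a0 aL; rewrite -[a]invrK lef_pV2 ?posrE ?expR_gt0 ?invr_gt0.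
  split; apply: inv => //; rewrite ?divr_gt0 //.
    by apply: le_trans le; rewrite invf_div /L; lra.
  by apply: le_trans le; rewrite invrK; lra.
near=> n.
have n4g : (4 * g * r.+2 <= n)%N by near: n; exact: nbhs_infty_ge.
have nr : (2 * 2 * r.+1 <= n)%N by near: n; exact: nbhs_infty_ge.
have n0 : (0 < n)%N by apply: leq_trans nr.
set om := p n * n%:R ^+ (r.+1 - 1).
have omA : (A + L) / c <= om by rewrite /om; near: n; exact: (cvgry_ge hp).
have omK : ((1 + g)%:R + L) * (2 * K)%:R <= om by rewrite /om; near: n; exact: (cvgry_ge hp).
have nK : (n ^ r <= K * 'C(n %/ 2, r))%N.
  by rewrite KE -mulnA; exact: bin_div_ge.
have uns : Hknp_prob n r.+1 (p n) (unsettled g) <= eps / 4.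
  apply: le_trans (unsP n (p n) n4g (hp01 n)) _.
  apply: le_trans (_ : expR (- L) <= _); last by case: expL.
  rewrite ler_expR -/om.
  have le : A - c * om <= - L.
    by move: omA; rewrite ler_pdivrMr // => le; lra.
  have n1 : 1 <= n%:R :> R by rewrite ler1n.
  have L0 : 0 <= L by rewrite addr_ge0 ?divr_ge0 // ltW.
  by nra.
have spr : Hknp_prob n r.+1 (p n) (fun H => ~ locally_sparse g H) <= 2 * (eps / 4).
  have zL : expR ((1 + g)%:R - p n * n%:R ^+ r / (2 * K)%:R) <= expR (- L).
    rewrite ler_expR; move: omK; rewrite -ler_pdivlMr ?ltr0n ?muln_gt0 //.
    by rewrite /om subn1 /= => le; lra.
  apply: le_trans (prob_not_sparse_le (hp01 n) K0 gE n0 nK _) _.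
    by apply: le_trans zL _; case: expL.
  by rewrite ler_wpM2l // (le_trans zL) //; case: expL.
rewrite Hknp_probC opprB addrC subrK ger0_norm; last first.
  by apply: sumr_ge0 => H _; exact: Hknp_mass_ge0.
apply: le_lt_trans (Hknp_prob_le_or (E1 := unsettled g)
  (E2 := fun H => ~ locally_sparse g H) (hp01 n) _) _.
  move=> H torsion; apply: contrapT => /not_orP[settled /contrapT sparse]; apply: torsion.
  apply: torsion_free_of_sparse sparse _ => q Y kY sY.
  by apply: settled; exists q, Y.
by apply: le_lt_trans (lerD uns spr) _; lra.
Unshelve. all: by end_near.
Qed.
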